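(* Let $X$ be a compact Riemann surface, $G$ a connected semisimple complex Lie group with centre $Z$, and $\Gamma$ a finite subgroup of $\mathrm{Aut}(X)\times\mathrm{Out}(G)\times\mathbb{C}^*$, with projections $\eta:\Gamma\to\mathrm{Aut}(X)$, $a:\Gamma\to\mathrm{Out}(G)$, $\mu:\Gamma\to\mathbb{C}^*$, acting on the moduli space $\mathcal{M}(X,G)$ of polystable $G$-Higgs bundles. Let $\theta:\Gamma\to\mathrm{Aut}(G)$ be any homomorphism lifting $a$. Let $\mathcal{M}_*(X,G)\subset\mathcal{M}(X,G)$ be the open subvariety of stable and simple $G$-Higgs bundles. For $c\in Z^2_a(\Gamma,Z)$ let $\widetilde{\mathcal{M}}(X,G,\Gamma,\theta,c,\bar\mu\theta)\subset\mathcal{M}(X,G)$ be the image of the moduli space of equivariantly polystable $(\theta,c,\bar\mu\theta)$-twisted $\Gamma$-equivariant $G$-Higgs bundles under the morphism forgetting the twisted $\Gamma$-action. Then $$\bigcup_{[c]\in H^2_a(\Gamma,Z)}\widetilde{\mathcal{M}}(X,G,\Gamma,\theta,c,\bar\mu\theta)\subset\mathcal{M}(X,G)^{\Gamma}$$ and $$\mathcal{M}_*(X,G)^{\Gamma}\subset\bigcup_{[c]\in H^2_a(\Gamma,Z)}\widetilde{\mathcal{M}}(X,G,\Gamma,\theta,c,\bar\mu\theta).$$ Moreover, the subvarieties $$\mathcal{M}_*(X,G)\cap\widetilde{\mathcal{M}}(X,G,\Gamma,\theta,c,\bar\mu\theta)=\mathcal{M}_*(X,G)^{\Gamma}\cap\widetilde{\mathcal{M}}(X,G,\Gamma,\theta,c,\bar\mu\theta)$$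 are all disjoint for different cohomology classes $[c]\in H^2_a(\Gamma,Z)$.
   Context: Let $\mathfrak g$ be the Lie algebra of $G$ and $K_X$ the canonical bundle. A $G$-Higgs bundle is a pair $(E,\phi)$ with $E$ a holomorphic principal $G$-bundle on $X$ and $\phi\in H^0(X,E(\mathfrak g)\otimes K_X)$, $E(\mathfrak g)$ the adjoint bundle. It is simple if its automorphism group (covering $\mathrm{id}_X$) is $Z$. Action. For $\theta\in\mathrm{Aut}(G)$, $\theta(E)$ is the extension of structure group of $E$ by $\theta$, and $\theta(\phi)$ is the induced Higgs field. Choosing a lift $\theta_\gamma\in\mathrm{Aut}(G)$ of $a_\gamma$, the right action is $(E,\phi)\cdot\gamma=(\eta_\gamma^*\theta_\gamma^{-1}(E),\mu_\gamma\eta_\gamma^*\theta_\gamma^{-1}(\phi))$ on isomorphism classes (independent of the lift). $\mathcal{M}(X,G)^\Gamma$ is the fixed locus and $\mathcal{M}_*(X,G)^\Gamma=\mathcal{M}_*(X,G)\cap\mathcal{M}(X,G)^\Gamma$. Cocycles. $Z^2_a(\Gamma,Z)$ is the set of maps $c:\Gamma\times\Gamma\to Z$ with $c(1,\gamma)=c(\gamma,1)=1$ and $a_\gamma(c(\gamma',\gamma''))c(\gamma,\gamma'\gamma'')=c(\gamma\gamma',\gamma'')c(\gamma,\gamma')$; $H^2_a(\Gamma,Z)$ is its quotient by the relation $c'(\gamma,\gamma')=c(\gamma,\gamma')a_\gamma(\beta(\gamma'))\beta(\gamma)\beta(\gamma\gamma')^{-1}$ for some $\beta:\Gamma\to Z$.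 Twisted equivariant Higgs bundles. $\Gamma$ acts on $X$ on the right by $x\cdot\gamma=\eta_\gamma^{-1}(x)$. A $(\theta,c)$-twisted $\Gamma$-equivariant $G$-bundle is a $G$-bundle $E$ with holomorphic maps $e\mapsto e\bullet\gamma$ ($\gamma\in\Gamma$) of its total space covering $x\mapsto x\cdot\gamma$, such that $(eg)\bullet\gamma=(e\bullet\gamma)\theta_\gamma^{-1}(g)$ and $(e\bullet\gamma)\bullet\gamma'=(e\,c(\gamma,\gamma'))\bullet(\gamma\gamma')$. A $(\theta,c,\bar\mu\theta)$-twisted $\Gamma$-equivariant $G$-Higgs bundle is such a bundle with a Higgs field $\phi$ invariant under the action of $\Gamma$ on $E(\mathfrak g)\otimes K_X$ given by $((e,v)\otimes k)\cdot\gamma=(e\bullet\gamma,\mu_\gamma\theta_\gamma^{-1}(v))\otimes\eta_\gamma^*k$ (here $\bar\mu=\mu^{-1}$ since $\Gamma$ is finite). The image $\widetilde{\mathcal M}$ depends only on the class of $c$. Stability. Fix a maximal compact $K\le G$ with Lie algebra $\mathfrak k$, invariant under $\theta(\Gamma)$, and a $G$-invariant nondegenerate symmetric bilinear form on $\mathfrak g$ (e.g. the Killing form). For $s\in i\mathfrak k$ put $P_s=\{g: e^{ts}ge^{-ts}\text{ bounded as }t\to\infty\}$, $L_s=\{g:\lim_{t\to\infty}e^{ts}ge^{-ts}=g\}$, with Lie algebras $\mathfrak p_s,\mathfrak l_s$. For $\sigma\in H^0(X,E(G/P_s))$ with associated $P_s$-bundle $E_\sigma$, put $\deg E(\sigma,s)=\frac{i}{2\pi}\int_X\chi_s(F_A)$,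 where $A$ is a connection on a smooth reduction of $E_\sigma$ to $K\cap L_s$ and $\chi_s=\langle s,\cdot\rangle$. $(E,\phi)$ is semistable (resp. stable) if $\deg E(\sigma,s)\ge0$ (resp. $>0$) for all $s\in i\mathfrak k$ (resp. $s\ne0$) and all $\sigma$ with $\phi\in H^0(E_\sigma(\mathfrak p_s)\otimes K_X)$; polystable if semistable and whenever $\deg E(\sigma,s)=0$ for such $\sigma$ there is $\sigma'\in H^0(X,E_\sigma(P_s/L_s))$ with $\phi\in H^0(E_{\sigma'}(\mathfrak l_s)\otimes K_X)$. Equivariant (semi-, poly-)stability of twisted equivariant Higgs bundles is defined identically but with $s\in i\mathfrak k^{\Gamma}$ (invariant under $\theta(\Gamma)$) and only $\Gamma$-invariant reductions $\sigma,\sigma'$ (with $\Gamma$ acting on $G/P_s$ and $P_s/L_s$ via $\theta$). Equivariantly polystable objects have polystable underlying $G$-Higgs bundle, so the forgetful morphism is defined. *)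

(* Defs.v *)
From HB Require Import structures.
From mathcomp Require Import all_boot all_order all_algebra.
From mathcomp Require Import complex.
From mathcomp Require Import all_classical all_reals all_analysis.
Import numFieldNormedType.Exports.
Import Order.TTheory GRing.Theory Num.Theory.

Set Implicit Arguments.
Unset Strict Implicit.
Unset Printing Implicit Defensive.

Local Open Scope classical_set_scope.
Local Open Scope ring_scope.
Local Open Scope complex_scope.

#[export, non_forgetful_inheritance]
HB.instance Definition _ (R : realType) := NormedModule.copy R[i] (R[i])^o.

(* ** Complex manifolds *)

(* [cinv] is only meaningful on the image of [cdom]. *)
Record chart (R : realType) (V : normedModType R[i]) (M : topologicalType) :=
  Chart { cdom : set M; cmap :> M -> V; cinv : V -> M }.

Section Charts.
Context {R : realType} {V : normedModType R[i]} {M : topologicalType}.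
Implicit Types c d : chart V M.

Definition is_chart c :=
  [/\ open (cdom c), open (c @` cdom c),
      forall x, cdom c x -> cinv c (c x) = x,
      forall x, cdom c x -> {for x, continuous c} &
      forall x, cdom c x -> {for c x, continuous (cinv c)}].

Definition compatible c d :=
  forall x, cdom c x -> cdom d x ->
    differentiable (d \o cinv c) (c x) /\ differentiable (c \o cinv d) (d x).

End Charts.

HB.mixin Record isComplexManifold (R : realType) (V : normedModType R[i]) M
    & Topological M := {
  atlas : set (chart V M);
  chart_at : M -> chart V M;
  atlas_chart : forall c, atlas c -> is_chart c;
  atlas_compatible : forall c d, atlas c -> atlas d -> compatible c d;
  atlas_maximal : forall c, is_chart c ->
    (forall d, atlas d -> compatible c d) -> atlas c;
  chart_at_atlas : forall x, atlas (chart_at x);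
  chart_at_dom : forall x, cdom (chart_at x) x;
  manifold_hausdorff : hausdorff_space M;
}.

#[short(type="complexManifoldType")]
HB.structure Definition ComplexManifold (R : realType) (V : normedModType R[i]) :=
  { M of Topological M & isComplexManifold R V M }.

Section Holomorphic.
Context {R : realType} {V W : normedModType R[i]}.

(* [f] is holomorphic at all points of the open set [D]. *)
Definition holo (M : complexManifoldType V) (N : complexManifoldType W)
    (D : set M) (f : M -> N) :=
  forall x, D x -> {for x, continuous f} /\
    forall (c : chart V M) (d : chart W N), atlas c -> atlas d ->
      cdom c x -> cdom d (f x) -> differentiable (d \o f \o cinv c) (c x).

End Holomorphic.

Section Near.
Context {K : numFieldType} {V W : normedModType K}.

Lemma is_diff_near (f g : V -> W) x (df : V -> W) :
  (\forall y \near x, f y = g y) -> is_diff x f df -> is_diff x g df.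
Proof.
move=> fg fdf.
have h0 : \forall y \near x, (g - f) y = 0.
  by apply: filterS fg => y /= e; rewrite -[LHS]/(g y - f y) e subrr.
pose z : {linear V -> W} := (\0%R : V -> W).
have cz : continuous z by move=> y; exact: cvg_cst.
have E : (g - f) \o shift x = cst ((g - f) x) + z +o_ 0 id.
  apply/eqaddoP => _/posnumP[e].
  have : \forall y \near (0:V), (g - f) (y + x) = 0.
    by move: h0; rewrite (near_shift 0) subr0.
  apply: filterS => y /= hy.
  rewrite -[X in `|X|]/((g - f) (y + x) - ((g-f) x + 0)) hy (nbhs_singleton h0).
  by rewrite addr0 subrr normr0 mulr_ge0.
have dz := diff_unique cz E.
have dg : is_diff x (g - f) (0 : V -> W).
  apply: DiffDef; last by rewrite dz.
  by apply/diff_locallyP; rewrite dz; split.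
have := is_diffD fdf dg.
by rewrite addr0 addrC subrK.
Qed.

Lemma near_differentiable (f g : V -> W) x :
  (\forall y \near x, f y = g y) -> differentiable f x ->
  differentiable g x /\ 'd g x = 'd f x :> (V -> W).
Proof.
by move=> fg /differentiableP /(is_diff_near fg) dg; split; [|exact: diff_val].
Qed.

End Near.

Section ChartTheory.
Context {R : realType} {V : normedModType R[i]}.

Lemma cinv_cvg (M : complexManifoldType V) (c : chart V M) x :
  atlas c -> cdom c x -> cinv c @ c x --> x.
Proof.
move=> /(atlas_chart c)[_ _ cK _ ci] cx.
have h : cinv c @ c x --> cinv c (c x) := ci _ cx.
by rewrite (cK _ cx) in h.
Qed.

Lemma chart_near (M : complexManifoldType V) (c : chart V M) x :
  atlas c -> cdom c x ->
  \forall p \near c x, cdom c (cinv c p) /\ c (cinv c p) = p.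
Proof.
move=> /(atlas_chart c)[_ oc cK _ _] cx.
have : nbhs (c x) (c @` cdom c) by apply: open_nbhs_nbhs; split => //; exists x.
by apply: filterS => p [y cy <-]; rewrite cK.
Qed.

Lemma near_cinv (M : complexManifoldType V) (c : chart V M) x (A : set M) :
  atlas c -> cdom c x -> nbhs x A -> \forall p \near c x, A (cinv c p).
Proof. by move=> ac cx; exact: cinv_cvg. Qed.

Lemma cdom_nbhs (M : complexManifoldType V) (c : chart V M) x :
  atlas c -> cdom c x -> nbhs x (cdom c).
Proof. by move=> /(atlas_chart c)[oc _ _ _ _] cx; apply: open_nbhs_nbhs. Qed.

End ChartTheory.

Section HoloTheory.
Context {R : realType} {V W U : normedModType R[i]}.

Lemma chart_comp (M : complexManifoldType V) (N : complexManifoldType W)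
    (P : normedModType R[i])
    (c : chart V M) (d : chart W N) (f : M -> N) (g : N -> P) x :
  atlas c -> atlas d -> cdom c x -> cdom d (f x) -> {for x, continuous f} ->
  differentiable (d \o f \o cinv c) (c x) ->
  differentiable (g \o cinv d) (d (f x)) ->
  differentiable (g \o f \o cinv c) (c x) /\
  'd (g \o f \o cinv c) (c x) =
    'd (g \o cinv d) (d (f x)) \o 'd (d \o f \o cinv c) (c x) :> (V -> P).
Proof.
move=> ac ad cx dx fx df dg.
have [_ _ cK _ _] := atlas_chart _ ac.
have [_ _ dK _ _] := atlas_chart _ ad.
have e : (d \o f \o cinv c) (c x) = d (f x) by rewrite /= cK.
rewrite -e in dg *.
have nr : \forall p \near c x,
    ((g \o cinv d) \o (d \o f \o cinv c)) p = (g \o f \o cinv c) p.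
  apply: filterS (near_cinv ac cx (fx _ (cdom_nbhs ad dx))) => p /= hp.
  by rewrite dK.
have [h1 h2] := near_differentiable nr (differentiable_comp df dg).
split; first exact: h1.
by rewrite h2; exact: (diff_comp df dg).
Qed.

Lemma holo_comp (M : complexManifoldType V) (N : complexManifoldType W)
    (P : complexManifoldType U) (A : set M) (B : set N) (f : M -> N) (g : N -> P) :
  holo A f -> holo B g -> (forall x, A x -> B (f x)) -> holo A (g \o f).
Proof.
move=> hf hg AB x Ax; have [cf df] := hf x Ax; have [cg dg] := hg _ (AB _ Ax).
split; first exact: continuous_comp.
move=> c e ac ae cx ex.
have [ad dx] := (chart_at_atlas (f x), chart_at_dom (f x)).
have [] // := chart_comp (g := e \o g) ac ad cx dx cf.
- exact: df.
- exact: dg.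
Qed.

End HoloTheory.

Local Open Scope group_scope.

(* ** Complex Lie groups *)

HB.mixin Record isComplexLieGroup (R : realType) (n : nat) G
    & Group G & ComplexManifold R 'rV[R[i]]_n G := {
  mulg_continuous : continuous (fun p : G * G => p.1 * p.2);
  mulg_holo : forall (c d e : chart 'rV[R[i]]_n G) (x y : G),
    atlas c -> atlas d -> atlas e -> cdom c x -> cdom d y -> cdom e (x * y) ->
    differentiable (fun p : 'rV[R[i]]_n * 'rV[R[i]]_n =>
       e (cinv c p.1 * cinv d p.2)) (c x, d y);
  invg_holo : holo setT (fun x : G => x^-1);
}.

#[short(type="complexLieGroupType")]
HB.structure Definition ComplexLieGroup (R : realType) (n : nat) :=
  { G of isComplexLieGroup R n G & Group G & ComplexManifold R 'rV[R[i]]_n G }.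

Section LieGroup.
Context {R : realType} {n : nat}.
Variable G : complexLieGroupType R n.
Local Notation lie := 'rV[R[i]]_n.

(* The Lie algebra T_1 G is identified with C^n through the chart [chart1]. *)
Definition chart1 : chart lie G := chart_at 1.

(* Differential at 1 of a map G -> G fixing 1. *)
Definition d1 (f : G -> G) : lie -> lie :=
  'd (chart1 \o f \o cinv chart1) (chart1 1).

Definition Ad (g : G) : lie -> lie := d1 (fun x => g * x * g^-1).

(* [u, v] is the derivative of g |-> Ad g v at 1 in the direction u. *)
Definition lie_bracket (u v : lie) : lie :=
  'd (fun p => Ad (cinv chart1 p) v) (chart1 1) u.

Definition lie_ideal (I : {vspace lie}) :=
  forall u v, v \in I -> lie_bracket u v \in I.

Definition lie_derived (I : {vspace lie}) : {vspace lie} :=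
  <<[seq lie_bracket u v | u <- vbasis I, v <- vbasis I]>>%VS.

Definition lie_solvable (I : {vspace lie}) :=
  exists k, iter k lie_derived I = 0%VS.

Definition semisimple :=
  forall I : {vspace lie}, lie_ideal I -> lie_solvable I -> I = 0%VS.

Definition lie_center : set G := [set z | forall g, z * g = g * z].

Definition is_subgroup (H : set G) :=
  H 1 /\ forall x y, H x -> H y -> H (x * y^-1).

Definition maximal_compact (K : set G) :=
  [/\ compact K, is_subgroup K &
      forall K', compact K' -> is_subgroup K' -> K `<=` K' -> K' = K].

Definition invariant_form (B : lie -> lie -> R[i]) :=
  [/\ forall u v, B u v = B v u,
      forall a u v w, (B (a *: u + v) w = a * B u w + B v w)%R,
      forall u, (forall v, B u v = 0%R) -> u = 0%R &
      forall g u v, B (Ad g u) (Ad g v) = B u v].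

(* [lam] is the (unique) one-parameter subgroup t |-> e^{tv}. *)
Definition one_param (v : lie) (lam : R -> G) :=
  [/\ continuous lam,
      forall s t, lam (s + t)%R = lam s * lam t &
      (fun t : R => (t^-1)%:C *: (chart1 (lam t) - chart1 1%g))%R @ 0%R^' --> v].

Definition Lie_of (H : set G) : set lie :=
  [set v | exists2 lam, one_param v lam & forall t, H (lam t)].

(* Bounded means contained in a compact set. *)
Definition P_ (s : lie) : set G :=
  [set g | exists2 lam, one_param s lam &
     exists2 D : set G, compact D &
       \forall t \near +oo%R, D (lam t * g * (lam t)^-1)].

Definition L_ (s : lie) : set G :=
  [set g | exists2 lam, one_param s lam &
     (fun t => lam t * g * (lam t)^-1) @ +oo%R --> g].

(* Holomorphic automorphisms of G. *)
Record lieAut := LieAut {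
  la_fun :> G -> G;
  la_inv : G -> G;
  la_funK : cancel la_fun la_inv;
  la_invK : cancel la_inv la_fun;
  la_mul : {morph la_fun : x y / x * y};
  la_holo : holo setT la_fun;
  la_inv_holo : holo setT la_inv }.

(* The class of [f] in Out(G) = Aut(G) / Inn(G). *)
Definition out_class (f : lieAut) : set lieAut :=
  [set f' | exists h : G, forall x, f' x = f (h * x * h^-1)].

(* The quotient Out(G), as a set of classes. *)
Record outG := OutG {
  out_set :> set lieAut;
  out_setP : exists f, out_set = out_class f }.

Definition out_mul (A B : set lieAut) : set lieAut :=
  [set f | exists f1 f2, [/\ A f1, B f2 & forall x, f x = f1 (f2 x)]].

Definition out_one : set lieAut :=
  [set f | exists h : G, forall x, f x = h * x * h^-1].

End LieGroup.

Section LieTheory.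
Context {R : realType} {n : nat} {G : complexLieGroupType R n}.
Local Notation lie := 'rV[R[i]]_n.

Lemma holo_mulg (V : normedModType R[i]) (M : complexManifoldType V) (A : set M)
    (f h : M -> G) :
  holo A f -> holo A h -> holo A (fun x => f x * h x).
Proof.
move=> hf hh x Ax; have [cf df] := hf x Ax; have [ch dh] := hh x Ax.
split.
  have pc : {for x, continuous (fun y => (f y, h y))} by apply: cvg_pair.
  exact: (continuous_comp pc (@mulg_continuous R n G (f x, h x))).
move=> c e ac ae cx ex.
have [a1 d1] := (chart_at_atlas (f x), chart_at_dom (f x)).
have [a2 d2] := (chart_at_atlas (h x), chart_at_dom (h x)).
set c1 := chart_at (f x) in a1 d1; set c2 := chart_at (h x) in a2 d2.
have [_ _ cK _ _] := atlas_chart _ ac.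
have [_ _ K1 _ _] := atlas_chart _ a1.
have [_ _ K2 _ _] := atlas_chart _ a2.
have dm := mulg_holo _ _ _ _ _ a1 a2 ae d1 d2 ex.
have dp := differentiable_pair (df _ _ ac a1 cx d1) (dh _ _ ac a2 cx d2).
have nr : \forall p \near c x,
    ((fun p => e (cinv c1 p.1 * cinv c2 p.2)) \o
      (fun p => ((c1 \o f \o cinv c) p, (c2 \o h \o cinv c) p))) p =
    (e \o (fun x => f x * h x) \o cinv c) p.
  apply: filterS2 (near_cinv ac cx (cf _ (cdom_nbhs a1 d1)))
    (near_cinv ac cx (ch _ (cdom_nbhs a2 d2))) => p /= h1 h2.
  by rewrite K1 // K2.
have [|d3 _] := near_differentiable nr; last exact: d3.
apply: differentiable_comp; first exact: dp.
by rewrite /= !cK.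
Qed.

Lemma holo_cst (V : normedModType R[i]) (M : complexManifoldType V) (A : set M)
    (g : G) : holo A (fun=> g).
Proof.
move=> x Ax; split; first exact: cst_continuous.
move=> c d _ _ _ _; rewrite (_ : _ \o _ = cst (d g)) //.
Qed.

Lemma holo_id (V : normedModType R[i]) (M : complexManifoldType V) (A : set M) :
  holo A (@idfun M).
Proof.
move=> x Ax; split; first exact: cvg_id.
move=> c d ac ad cx dx; rewrite (_ : _ \o _ = d \o cinv c) //.
by have [] := atlas_compatible _ _ ac ad x cx dx.
Qed.

Lemma holo_conj g : holo setT (fun x : G => g * x * g^-1).
Proof.
by apply: holo_mulg (holo_cst _); apply: holo_mulg (holo_cst _) (@holo_id _ _ _).
Qed.

Lemma chart1_atlas : atlas (chart1 G). Proof. exact: chart_at_atlas. Qed.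
Lemma chart1_dom : cdom (chart1 G) 1. Proof. exact: chart_at_dom. Qed.

Lemma d1_comp (f g : G -> G) : holo setT f -> holo setT g -> f 1 = 1 -> g 1 = 1 ->
  d1 (f \o g) =1 d1 f \o d1 g.
Proof.
move=> hf hg f1 g1 v.
have [cg dg] := hg 1 I; have [cf df] := hf 1 I.
have a1 := chart1_atlas; have D1 := chart1_dom.
have dg1 : cdom (chart1 G) (g 1) by rewrite g1.
have := chart_comp (g := chart1 G \o f) a1 a1 D1 dg1 cg (dg _ _ a1 a1 D1 dg1).
rewrite g1 => -[]; first by apply: df => //; rewrite f1.
by move=> _ /(congr1 (fun F => F v)).
Qed.

Lemma d1_continuous (f : G -> G) : holo setT f -> f 1 = 1 -> continuous (d1 f).
Proof.
move=> hf f1; have [_ df] := hf 1 I; have a1 := chart1_atlas; have D1 := chart1_dom.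
by apply: diff_continuous; apply: df => //; rewrite f1.
Qed.

Lemma la_one (f : lieAut G) : f 1 = 1.
Proof.
have := la_mul f 1 1; rewrite mulg1 => /(congr1 (fun y => (f 1)^-1 * y)).
by rewrite mulVg mulgA mulVg mul1g.
Qed.

Lemma la_invg (f : lieAut G) x : f x^-1 = (f x)^-1.
Proof.
have := la_mul f x x^-1; rewrite mulgV la_one => /(congr1 (fun y => (f x)^-1 * y)).
by rewrite mulgA mulVg mul1g mulg1.
Qed.

Lemma d1_Ad (f : lieAut G) g v : d1 f (Ad g v) = Ad (f g) (d1 f v).
Proof.
have hf := la_holo f; have f1 := la_one f.
have c1 a : a * 1 * a^-1 = 1 :> G by rewrite mulg1 mulgV.
have e1 := d1_comp hf (holo_conj g) f1 (c1 g) v.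
have e2 := d1_comp (holo_conj (f g)) hf (c1 (f g)) f1 v.
rewrite -[LHS]e1 -[RHS]e2.
by congr (d1 _ v); apply/funext => x /=; rewrite !la_mul la_invg.
Qed.

Lemma la_inv_mul (f : lieAut G) : {morph la_inv f : x y / x * y}.
Proof. by move=> x y; apply: (can_inj (la_funK f)); rewrite la_mul !la_invK. Qed.

Definition lieAut_inv (f : lieAut G) : lieAut G :=
  @LieAut R n G (la_inv f) f (la_invK f) (la_funK f)
    (@la_inv_mul f) (la_inv_holo f) (la_holo f).

End LieTheory.

(* ** Holomorphic principal bundles and Higgs bundles on X *)

Lemma linear_scalar (R : realType)
  (f : {linear (R[i] : normedModType R[i]) -> (R[i] : normedModType R[i])}) t :
  f t = (t * f 1)%R.
Proof.
by have := linearZ_LR f t 1%R; rewrite -[(t *: 1)%R]/(t * 1)%R mulr1.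
Qed.

Section Bundles.
Context {R : realType} (X : complexManifoldType (R[i] : normedModType R[i])).

(* Holomorphic automorphisms of X. *)
Record holAut := HolAut {
  ha_fun :> X -> X;
  ha_inv : X -> X;
  ha_funK : cancel ha_fun ha_inv;
  ha_invK : cancel ha_inv ha_fun;
  ha_holo : holo setT ha_fun;
  ha_inv_holo : holo setT ha_inv }.

(* Each cotangent line K_x is trivialised by dz_x, where z_x := chart_at x.
   In these terms dz_x = cotr c x * dc for any chart c around x, and
   f^*dz_{f(x)} = cotr_map f x * dz_x. *)
Definition cotr (c : chart (R[i] : normedModType R[i]) X) (x : X) : R[i] :=
  'd (chart_at x \o cinv c) (c x) 1%R.

Definition cotr_map (f : X -> X) (x : X) : R[i] :=
  'd (chart_at (f x) \o f \o cinv (chart_at x)) (chart_at x x) 1%R.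

Context {n : nat} (G : complexLieGroupType R n).
Local Notation lie := 'rV[R[i]]_n.

(* A holomorphic principal G-bundle, given by its total space, its right
   G-action and an atlas of local trivialisations (x, g) |-> s(x)g with
   holomorphic transition functions; [local_sec U s] says that s : U -> E is
   the section defining one of them. *)
Record gBundle := GBundle {
  total :> Type;
  bproj : total -> X;
  bact : total -> G -> total;
  local_sec : set X -> (X -> total) -> Prop;
  bact1 : forall e, bact e 1 = e;
  bactM : forall e g h, bact e (g * h) = bact (bact e g) h;
  bproj_act : forall e g, bproj (bact e g) = bproj e;
  bact_free_trans : forall e e', bproj e = bproj e' -> exists! g, e' = bact e g;
  local_sec_open : forall U s, local_sec U s -> open U;
  local_sec_proj : forall U s, local_sec U s -> forall x, U x -> bproj (s x) = x;
  local_sec_cover : forall x, exists U s, local_sec U s /\ U x;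
  local_sec_holo : forall U s U' s', local_sec U s -> local_sec U' s' ->
    exists2 h : X -> G, holo (U `&` U') h &
      forall x, U x -> U' x -> s' x = bact (s x) (h x) }.

(* A G-Higgs bundle. The Higgs field, a section of E(g) (x) K, as a G-equivariant function on
   the total space: phi(x) = [e, higgs e] (x) dz_x for e in E_x. *)
Record higgsBundle := HiggsBundle {
  hb_bundle :> gBundle;
  higgs : hb_bundle -> lie;
  higgs_act : forall e g, higgs (bact e g) = Ad g^-1 (higgs e);
  higgs_holo : forall U s, local_sec U s -> forall x, U x ->
    exists c, [/\ atlas c, cdom c x &
      forall y, U y -> cdom c y ->
        differentiable (fun p => cotr c (cinv c p) *: higgs (s (cinv c p)))%R
                       (c y)] }.

Section Extension.
Variable (psi : lieAut G).
Section ExtB.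
Variable E : gBundle.

(* As psi is bijective, the extension of structure group E x_psi G is
   identified with E through [e, g] |-> e psi^{-1}(g); G acts via psi^{-1}. *)
Definition ext_act (e : E) (g : G) := bact e (lieAut_inv psi g).

Lemma ext_act1 e : ext_act e 1 = e.
Proof. by rewrite /ext_act la_one bact1. Qed.

Lemma ext_actM e g h : ext_act e (g * h) = ext_act (ext_act e g) h.
Proof. by rewrite /ext_act la_mul bactM. Qed.

Lemma ext_act_free (e e' : E) : bproj e = bproj e' -> exists! g, e' = ext_act e g.
Proof.
move=> /bact_free_trans [g [-> gu]]; exists (psi g).
split; first by rewrite /ext_act /= la_funK.
by move=> h /gu ->; rewrite /= la_invK.
Qed.

Lemma ext_sec_holo U (s : X -> E) U' s' : local_sec U s -> local_sec U' s' ->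
  exists2 h : X -> G, holo (U `&` U') h &
    forall x, U x -> U' x -> s' x = ext_act (s x) (h x).
Proof.
move=> hs hs'; have [h hh e] := local_sec_holo hs hs'.
exists (psi \o h).
  by apply: (holo_comp hh (@la_holo _ _ _ psi)) => x _.
by move=> x Ux U'x; rewrite /ext_act /= la_funK -e.
Qed.

Definition ext_bundle : gBundle :=
  @GBundle E (@bproj E) ext_act (@local_sec E) ext_act1 ext_actM
    (fun e g => bproj_act _ _) ext_act_free (@local_sec_open E)
    (@local_sec_proj E) (@local_sec_cover E) ext_sec_holo.
End ExtB.

Variable H : higgsBundle.
Definition ext_field (e : ext_bundle H) : lie := d1 psi (higgs (e : H)).

Lemma ext_field_act e g : ext_field (bact e g) = Ad g^-1 (ext_field e).
Proof.
rewrite /ext_field -[bact e g]/(bact (e : H) (lieAut_inv psi g)) higgs_act d1_Ad.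
by rewrite -la_invg /= la_invK.
Qed.

Lemma ext_field_holo U s : @local_sec (ext_bundle H) U s -> forall x, U x ->
  exists c, [/\ atlas c, cdom c x &
    forall y, U y -> cdom c y ->
      differentiable (fun p => cotr c (cinv c p) *: ext_field (s (cinv c p)))%R
                     (c y)].
Proof.
move=> hs x Ux; have [c [ac cx dc]] := higgs_holo (hs : @local_sec H U s) Ux.
exists c; split=> // y Uy cy.
have dF := dc y Uy cy; set F := (fun p => _) in dF.
have -> : (fun p => (cotr c (cinv c p) *: ext_field (s (cinv c p)))%R) =
          ('d (chart1 G \o psi \o cinv (chart1 G)) (chart1 G 1) \o F).
  by apply/funext => p; rewrite /F /ext_field /d1 /= linearZ.
apply: (differentiable_comp dF); apply: linear_differentiable.
by apply: (@d1_continuous _ _ _ psi); [exact: la_holo|exact: la_one].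
Qed.

Definition ext_higgs : higgsBundle :=
  @HiggsBundle (ext_bundle H) ext_field ext_field_act ext_field_holo.
End Extension.

Section Pullback.
Variable (eta : holAut).
Section PullB.
Variable E : gBundle.

(* As eta is bijective, eta^*E = {(x, e) | eta x = proj e} is identified with
   E through (x, e) |-> e. *)
Definition pull_bproj (e : E) : X := ha_inv eta (bproj e).
Definition pull_sec (U : set X) (s : X -> E) :=
  exists U0 s0, [/\ local_sec U0 s0, U = eta @^-1` U0 & s = s0 \o eta].

Lemma pull_bproj_act e g : pull_bproj (bact e g) = pull_bproj e.
Proof. by rewrite /pull_bproj bproj_act. Qed.

Lemma pull_free (e e' : E) : pull_bproj e = pull_bproj e' -> exists! g, e' = bact e g.
Proof. by move=> /(can_inj (ha_invK eta)); exact: bact_free_trans. Qed.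

Lemma pull_open U s : pull_sec U s -> open U.
Proof.
move=> [U0 [s0 [h -> _]]]; apply: open_comp (local_sec_open h) => x _.
exact: (@ha_holo eta x I).1.
Qed.

Lemma pull_sec_proj U s : pull_sec U s -> forall x, U x -> pull_bproj (s x) = x.
Proof.
move=> [U0 [s0 [h -> ->]]] x Ux.
by rewrite /pull_bproj /= (local_sec_proj h) // ha_funK.
Qed.

Lemma pull_cover x : exists U s, pull_sec U s /\ U x.
Proof.
have [U [s [h Ux]]] := local_sec_cover E (eta x).
by exists (eta @^-1` U), (s \o eta); split=> //; exists U, s.
Qed.

Lemma pull_sec_holo U s U' s' : pull_sec U s -> pull_sec U' s' ->
  exists2 h : X -> G, holo (U `&` U') h &
    forall x, U x -> U' x -> s' x = bact (s x) (h x).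
Proof.
move=> [U0 [s0 [hs -> ->]]] [U1 [s1 [hs' -> ->]]].
have [h hh e] := local_sec_holo hs hs'.
exists (h \o eta); last by move=> x Ux U'x /=; rewrite -e.
have he : holo (eta @^-1` U0 `&` eta @^-1` U1) eta.
  by move=> x _; exact: (@ha_holo eta x I).
exact: (holo_comp he hh).
Qed.

Definition pull_bundle : gBundle :=
  @GBundle E pull_bproj (@bact E) pull_sec (@bact1 E) (@bactM E) pull_bproj_act
    pull_free pull_open pull_sec_proj pull_cover pull_sec_holo.
End PullB.

Lemma pull_chart (c : chart (R[i] : normedModType R[i]) X) : atlas c ->
  atlas (Chart (eta @^-1` cdom c) (c \o eta) (ha_inv eta \o cinv c)).
Proof.
move=> ac; have [oc ocd cK cc ci] := atlas_chart _ ac.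
have ce x := (@ha_holo eta x I).1.
have cie x := (@ha_inv_holo eta x I).1.
apply: atlas_maximal.
  split=> /=.
  - by apply: open_comp oc => x _; exact: ce.
  - rewrite (_ : _ @` _ = c @` cdom c) //; rewrite predeqE => p; split.
      by move=> [x cx <-]; exists (eta x).
    by move=> [x cx <-]; exists (ha_inv eta x); rewrite /= ?ha_invK.
  - by move=> x cx; rewrite cK // ha_funK.
  - move=> x cx; have := cc _ cx; exact: (continuous_comp (ce x)).
  - move=> x cx; have := cie (cinv c (c (eta x))).
    exact: (continuous_comp (ci _ cx)).
move=> d ad x /= cx dx; split.
  by have [_ dh] := @ha_inv_holo eta (eta x) I; apply: dh; rewrite ?ha_funK.
by have [_ dh] := @ha_holo eta x I; apply: dh.
Qed.

Lemma pull_cotr (c : chart (R[i] : normedModType R[i]) X) (y : X) :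
  atlas c -> cdom c (eta y) ->
  (cotr (Chart (eta @^-1` cdom c) (c \o eta) (ha_inv eta \o cinv c)) y *
    cotr_map eta y = cotr c (eta y))%R.
Proof.
move=> ac cy; set z := chart_at y; set z' := chart_at (eta y).
have az : atlas z := chart_at_atlas _; have dz : cdom z y := chart_at_dom _.
have az' : atlas z' := chart_at_atlas _.
have dz' : cdom z' (eta y) := chart_at_dom _.
have [ci di] := @ha_inv_holo eta (eta y) I.
have [ce de] := @ha_holo eta y I.
have iy : ha_inv eta (eta y) = y by rewrite ha_funK.
have dzi : cdom z (ha_inv eta (eta y)) by rewrite iy.
have [] := @chart_comp R _ _ X X _ c z (ha_inv eta) (z' \o eta) (eta y)
   ac az cy dzi ci (di _ _ ac az cy dzi).
  by rewrite iy; apply: de.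
move=> _ /(congr1 (fun F => F (1 : R[i])%R)) /=.
rewrite iy /cotr /cotr_map -/z -/z' /=.
rewrite (_ : ((z' \o eta) \o ha_inv eta) \o cinv c = z' \o cinv c); last first.
  by apply/funext => p /=; rewrite ha_invK.
move=> h; apply: etrans (esym h); apply: esym.
exact: (linear_scalar ('d (z' \o eta \o cinv z) (z y))).
Qed.

Variable H : higgsBundle.
Definition pull_field (e : pull_bundle H) : lie :=
  (cotr_map eta (bproj e) *: higgs (e : H))%R.

Lemma pull_field_act e g : pull_field (bact e g) = Ad g^-1 (pull_field e).
Proof.
rewrite /pull_field bproj_act -[bact e g]/(bact (e : H) g) higgs_act.
by rewrite /Ad /d1 linearZ.
Qed.

Lemma pull_field_holo U s : @local_sec (pull_bundle H) U s -> forall x, U x ->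
  exists c, [/\ atlas c, cdom c x &
    forall y, U y -> cdom c y ->
      differentiable (fun p => cotr c (cinv c p) *: pull_field (s (cinv c p)))%R
                     (c y)].
Proof.
move=> [U0 [s0 [hs -> ->]]] x Ux.
have [c [ac cx dc]] := higgs_holo hs Ux.
exists (Chart (eta @^-1` cdom c) (c \o eta) (ha_inv eta \o cinv c)).
split=> //; first exact: pull_chart.
move=> y Uy cy; have dF := dc _ Uy cy; set F := (fun p => _) in dF.
have oU : nbhs (eta y) U0.
  by apply: open_nbhs_nbhs; split=> //; exact: (local_sec_open hs).
set c' := Chart _ _ _.
have nr : \forall p \near c (eta y), F p =
    (cotr c' (cinv c' p) *: pull_field ((s0 \o eta) (cinv c' p)))%R; last first.
  by have [df _] := near_differentiable nr dF.
apply: filterS2 (chart_near ac cy) (near_cinv ac cy oU) => p [cp _] Up.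
rewrite /= /pull_field /= /pull_bproj (local_sec_proj hs) ?ha_invK // scalerA.
by rewrite pull_cotr ?ha_invK.
Qed.

Definition pull_higgs : higgsBundle :=
  @HiggsBundle (pull_bundle H) pull_field pull_field_act pull_field_holo.
End Pullback.

Section Scaling.
Variable (a : R[i]) (H : higgsBundle).
Definition scale_field (e : H) : lie := (a *: higgs e)%R.

Lemma scale_field_act e g : scale_field (bact e g) = Ad g^-1 (scale_field e).
Proof. by rewrite /scale_field higgs_act /Ad /d1 linearZ. Qed.

Lemma scale_field_holo U s : @local_sec H U s -> forall x, U x ->
  exists c, [/\ atlas c, cdom c x &
    forall y, U y -> cdom c y ->
      differentiable (fun p => cotr c (cinv c p) *: scale_field (s (cinv c p)))%R
                     (c y)].
Proof.
move=> hs x Ux; have [c [ac cx dc]] := higgs_holo hs Ux.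
exists c; split=> // y Uy cy.
have dF := dc y Uy cy; set F := (fun p => _) in dF.
have -> : (fun p => (cotr c (cinv c p) *: scale_field (s (cinv c p)))%R) =
          (a *: F)%R.
  have sC (u v : R[i]) (w : lie) : (u *: (v *: w) = v *: (u *: w))%R.
    by rewrite !scalerA mulrC.
  by apply/funext => p; exact: sC.
exact: differentiableZ.
Qed.

Definition scale_higgs : higgsBundle :=
  @HiggsBundle H scale_field scale_field_act scale_field_holo.
End Scaling.

End Bundles.

Local Close Scope group_scope.

(* Loaded only here because it would shadow the class name [Group]. *)
From mathcomp Require Import fingroup.

(* ** Real-smooth functions on open subsets of C, and integration over C *)

Section RealCalculus.
Context {R : realType} {W : normedModType R[i]}.
Implicit Types (D : set R[i]) (f : R[i] -> W).

Definition pquot (w : R[i]) f (p : R[i]) (t : R) : W :=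
  (t^-1)%:C *: (f (p + t%:C * w) - f p).

(* Derivative in the real direction w; w = 1, i give d/dx and d/dy. *)
Definition pderiv (w : R[i]) f (p : R[i]) : W := lim (pquot w f p @ 0^').

Fixpoint smooth_upto (k : nat) D f : Prop :=
  (forall p, D p -> {for p, continuous f}) /\
  if k is k'.+1 then
    forall w : R[i], w = 1 \/ w = 'i%C ->
      (forall p, D p -> cvg (pquot w f p @ 0^')) /\
      smooth_upto k' D (pderiv w f)
  else True.

Definition smooth D f := forall k, smooth_upto k D f.

End RealCalculus.

Section ComplexIntegral.
Context {R : realType}.

Definition plane (D : set R[i]) :
    set (measurableTypeR R * measurableTypeR R) :=
  [set q | D (q.1 +i* q.2)].

Definition leb2 := (@lebesgue_measure R \x @lebesgue_measure R)%E.

Definition cintegral (D : set R[i]) (g : R[i] -> R[i]) : R[i] :=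
  (\int[leb2]_(q in plane D) complex.Re (g (q.1 +i* q.2))) +i*
  (\int[leb2]_(q in plane D) complex.Im (g (q.1 +i* q.2))).

End ComplexIntegral.

Local Open Scope group_scope.

Definition compact_riemann_surface (R : realType)
    (X : complexManifoldType (R[i] : normedModType R[i])) :=
  [/\ [set: X] !=set0, connected [set: X] & compact [set: X]].

Section Moduli.
Context {R : realType} {X : complexManifoldType (R[i] : normedModType R[i])}.
Context {n : nat} {G : complexLieGroupType R n}.
Local Notation lie := 'rV[R[i]]_n.
Local Notation chartX := (chart (R[i] : normedModType R[i]) X).

Definition msmooth (U : set X) (h : X -> G) :=
  (forall x, U x -> {for x, continuous h}) /\
  forall (c : chartX) (d : chart lie G), atlas c -> atlas d ->
    smooth (c @` (U `&` cdom c `&` h @^-1` cdom d)) (d \o h \o cinv c).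

(* ** Sections, reductions of structure group, connections *)

Section Bundle.
Variable E : gBundle X G.
Implicit Types (U : set X) (f s : X -> E) (S F : set E) (H : set G).

Definition section_of (reg : set X -> (X -> G) -> Prop) U f :=
  [/\ open U, forall x, U x -> bproj (f x) = x &
      forall U' s, local_sec U' s -> exists2 h, reg (U `&` U') h &
        forall x, U x -> U' x -> f x = bact (s x) (h x)].

Definition holo_section := section_of (@holo R _ _ X G).
Definition smooth_section := section_of msmooth.

(* A section of E(G/H) = E/H, viewed as the union S of the H-orbits it picks
   in the fibres of E (so S is the associated H-bundle). It is holomorphic
   iff it lifts locally to holomorphic sections of E. *)
Definition reduction (sec : set X -> (X -> E) -> Prop) H S :=
  (forall e g, S e -> (S (bact e g) <-> H g)) /\
  forall x, exists U f, [/\ U x, sec U f & forall y, U y -> S (f y)].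

Definition local_frame F U f := smooth_section U f /\ forall x, U x -> F (f x).

(* The left-logarithmic derivative h^{-1} dh at x, in the direction of the
   tangent vector with coordinate w in chart_at x. *)
Definition log_deriv (h : X -> G) (x : X) (w : R[i]) : lie :=
  pderiv w (fun p => chart1 G ((h x)^-1 * h (cinv (chart_at x) p)))
         (chart_at x x).

(* A connection on the smooth H-bundle F, given by its gauge potentials:
   [A f x w] is the value at x of the potential in the frame f, on the tangent
   vector with coordinate w in chart_at x. *)
Definition connection H F (A : (X -> E) -> X -> R[i] -> lie) :=
  [/\ forall U f x (a : R) w w', local_frame F U f -> U x ->
        (A f x (a%:C * w + w') = a%:C *: A f x w + A f x w')%R,
      forall U f x w, local_frame F U f -> U x -> Lie_of H (A f x w),
      forall U f (c : chartX) w, local_frame F U f -> atlas c ->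
        smooth (c @` (U `&` cdom c))
          (fun p => A f (cinv c p) (cotr c (cinv c p) * w)%R) &
      forall U f U' f' (h : X -> G), local_frame F U f -> local_frame F U' f' ->
        (forall x, U x -> U' x -> f' x = bact (f x) (h x)) ->
        forall x w, U x -> U' x ->
          A f' x w = (Ad (h x)^-1%g (A f x w) + log_deriv h x w)%R].

(* The coefficient of dx /\ dy in the curvature dA + [A, A]/2, in the frame f
   and the coordinate c = x + iy. *)
Definition curvature (A : (X -> E) -> X -> R[i] -> lie) (f : X -> E)
    (c : chartX) (p : R[i]) : lie :=
  let a w q := A f (cinv c q) (cotr c (cinv c q) * w)%R in
  (pderiv 1 (a 'i%C) p - pderiv 'i%C (a 1) p +
   lie_bracket G (a 1 p) (a 'i%C p))%R.

Variables (K : set G) (B : lie -> lie -> R[i]).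

(* d is (i / 2 pi) times the integral over X of B s F_A, for some connection A
   on a smooth reduction F to K `&` L_s of the P_s-bundle S. The integral is
   computed on a finite partition of X into Borel sets lying in coordinate
   domains over which F has a frame. *)
Definition is_degree S (s : lie) (d : R[i]) :=
  exists F A, [/\ reduction smooth_section (K `&` L_ s) F, F `<=` S,
    connection (K `&` L_ s) F A &
    exists N (c : 'I_N -> chartX) (U : 'I_N -> set X) (f : 'I_N -> X -> E)
        (D : 'I_N -> set X),
      [/\ forall j, [/\ atlas (c j), local_frame F (U j) (f j),
                        D j `<=` U j `&` cdom (c j) &
                        measurable (plane (c j @` D j))],
          forall x, exists! j, D j x &
          d = ('i%C / (2 * pi)%:C *
               \sum_(j < N) cintegral (c j @` D j)
                 (fun p => B s (curvature A (f j) (c j) p)))%R]].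

(* All connections and partitions give the same d. *)
Definition degree S (s : lie) : R[i] := xget 0%R [set d | is_degree S s d].

End Bundle.

(* ** Stability *)

Section Stability.
Variables (K : set G) (B : lie -> lie -> R[i]) (H : higgsBundle X G).

Definition ik : set lie := [set s | exists2 k, Lie_of K k & s = 'i%C *: k]%R.

Definition higgs_red (S : set H) (h : set lie) := forall e, S e -> h (higgs e).

(* [I] and [J] restrict the parameters s and the reductions that are tested. *)
Section Restricted.
Variables (I : set lie) (J : set (set H)).

Definition tested s (S : set H) :=
  [/\ ik s, I s, reduction (@holo_section H) (P_ s) S, J S &
      higgs_red S (Lie_of (P_ s : set G))].

Definition semistable_for := forall s S, tested s S -> (0 <= degree K B S s)%R.

Definition stable_for :=
  forall s S, s != 0%R -> tested s S -> (0 < degree K B S s)%R.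

Definition polystable_for := semistable_for /\
  forall s S, tested s S -> degree K B S s = 0%R ->
    exists S' : set H, [/\ S' `<=` S, reduction (@holo_section H) (L_ s) S',
      J S' & higgs_red S' (Lie_of (L_ s : set G))].

End Restricted.

Definition semistable := semistable_for setT setT.
Definition stable := stable_for setT setT.
Definition polystable := polystable_for setT setT.

End Stability.

(* ** Morphisms and the moduli space *)

(* In local trivialisations F is (x, g) |-> (f x, h x * phi g), whenever F is
   phi-equivariant over f; so this says that F is holomorphic when phi is. *)
Definition bundle_holo (E E' : gBundle X G) (f : X -> X) (F : E -> E') :=
  forall U s U' s', @local_sec _ _ _ _ E U s -> @local_sec _ _ _ _ E' U' s' ->
    exists2 h : X -> G, holo (U `&` f @^-1` U') h &
      forall x, U x -> U' (f x) -> F (s x) = bact (s' (f x)) (h x).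

(* Such an F is bijective with holomorphic inverse, since G acts simply
   transitively on the fibres. *)
Definition is_higgs_iso (H H' : higgsBundle X G) (F : H -> H') :=
  [/\ forall e, bproj (F e) = bproj e,
      forall e g, F (bact e g) = bact (F e) g,
      bundle_holo id F &
      forall e, higgs (F e) = higgs e].

Definition higgs_iso (H H' : higgsBundle X G) :=
  exists F : H -> H', is_higgs_iso F.

Definition simple_higgs (H : higgsBundle X G) :=
  forall F : H -> H, is_higgs_iso F <->
    exists2 z, lie_center z & forall e, F e = bact e z.

Section ModuliSpace.
Variables (K : set G) (B : lie -> lie -> R[i]).

(* Points of M(X, G): isomorphism classes of polystable G-Higgs bundles. *)
Record moduli := Moduli {
  mclass : set (higgsBundle X G);
  mclassP : exists2 H, polystable K B H &
              mclass = [set H' | higgs_iso H H'] }.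

Definition moduli_stable_simple : set moduli :=
  [set m : moduli | exists H, [/\ mclass m H, stable K B H & simple_higgs H]].

(* ** The action of Gamma *)

Variable Gamma : finGroupType.
Variables (eta : Gamma -> holAut X) (a : Gamma -> outG G)
  (mu : Gamma -> R[i]).

(* (eta, a, mu) embeds Gamma as a subgroup of Aut(X) x Out(G) x C^*. *)
Definition finite_subgroup :=
  [/\ forall g h x, eta (g * h) x = eta g (eta h x),
      forall g h, out_set (a (g * h)) = out_mul (a g) (a h),
      (forall g, mu g != 0%R) /\ (forall g h, mu (g * h) = (mu g * mu h)%R) &
      forall g, eta g =1 id -> out_set (a g) = @out_one _ _ G -> mu g = 1%R ->
        g = 1].

(* (E, phi) . gamma, computed with the lift psi of a gamma. *)
Definition higgs_act_by (g : Gamma) (psi : lieAut G) (H : higgsBundle X G) :=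
  scale_higgs (mu g) (pull_higgs (eta g) (ext_higgs (lieAut_inv psi) H)).

(* Different lifts of a gamma give isomorphic Higgs bundles. *)
Definition moduli_fixed : set moduli :=
  [set m : moduli | forall g psi H, out_set (a g) psi -> mclass m H ->
     mclass m (higgs_act_by g psi H)].

(* ** Cocycles. The action of a gamma on the centre is that of any lift. *)

Definition Z2 : set (Gamma -> Gamma -> G) :=
  [set c | [/\ forall g h, lie_center (c g h),
               forall g, c 1 g = 1 /\ c g 1 = 1 &
               forall g g' g'' psi, out_set (a g) psi ->
                 psi (c g' g'') * c g (g' * g'') = c (g * g') g'' * c g g']].

Definition cohomologous (c c' : Gamma -> Gamma -> G) :=
  exists2 beta : Gamma -> G, forall g, lie_center (beta g) &
    forall g g' psi, out_set (a g) psi ->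
      c' g g' = c g g' * psi (beta g') * beta g * (beta (g * g'))^-1.

Definition H2_class (c : Gamma -> Gamma -> G) : set (Gamma -> Gamma -> G) :=
  [set c' | Z2 c' /\ cohomologous c c'].

(* ** Twisted equivariant Higgs bundles *)

Variable theta : Gamma -> lieAut G.

Definition is_lift :=
  (forall g, out_set (a g) (theta g)) /\
  (forall g h x, theta (g * h) x = theta g (theta h x)).

Section Twisted.
Variables (c : Gamma -> Gamma -> G) (H : higgsBundle X G) (b : Gamma -> H -> H).

Definition twisted_action :=
  [/\ forall g e, bproj (b g e) = ha_inv (eta g) (bproj e),
      forall g, bundle_holo (ha_inv (eta g)) (b g),
      forall g e x, b g (bact e x) = bact (b g e) (lieAut_inv (theta g) x) &
      forall g g' e, b g' (b g e) = b (g * g') (bact e (c g g'))].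

(* phi(x) = [e, higgs e] (x) dz_x is sent to
   [e.g, mu_g theta_g^-1 (higgs e)] (x) eta_g^* dz_x. *)
Definition twisted_higgs := forall g e,
  higgs (b g e) = (mu g *: (cotr_map (eta g) (bproj (b g e)) *:
                            d1 (lieAut_inv (theta g)) (higgs e)))%R.

Definition equivariantly_polystable :=
  polystable_for K B [set s : lie | forall g, d1 (theta g) s = s]
    [set S : set H | forall g e, S e -> S (b g e)].

End Twisted.

(* The points of M(X, G) underlying an equivariantly polystable twisted
   equivariant Higgs bundle, i.e. the image of the forgetful morphism. *)
Definition moduli_twisted (c : Gamma -> Gamma -> G) : set moduli :=
  [set m : moduli | exists (H : higgsBundle X G) (b : Gamma -> H -> H),
     [/\ mclass m H, twisted_action c b, twisted_higgs b &
         equivariantly_polystable b]].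

End ModuliSpace.
End Moduli.

(* Main.v *)
(** A twisted equivariant structure on [(E, phi)] is a family of isomorphisms
    [b g : (E, phi).g -> (E, phi)], multiplicative up to the central factor
    [c]. So a twisted bundle is fixed by [Gamma].
    Conversely, if [(E, phi)] is fixed and simple, any choice of the [b g] is
    multiplicative up to automorphisms, that is, up to central elements [c], and
    associativity is the cocycle condition; two families differ by a central
    cochain, so they have cohomologous cocycles. Stability implies equivariant
    polystability because the parameter [s = 0] has degree 0 and
    [P_0 = L_0 = G]. *)

Require Import Defs.
From HB Require Import structures.
From mathcomp Require Import all_boot all_order all_algebra fingroup complex.
From mathcomp Require Import all_classical all_reals all_analysis.
Import numFieldNormedType.Exports.

Local Open Scope classical_set_scope.

Set Implicit Arguments.
Unset Strict Implicit.
Unset Printing Implicit Defensive.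

Local Open Scope group_scope.

(** * Holomorphy as a local property *)

Section Holomorphic.
Context {R : realType} {V W : normedModType R[i]%C}.

(** [holo] constrains only the germ of [f] at each point, so the comparison map [g] may vary with
    the point. *)
Lemma holo_near (M : complexManifoldType V) (N : complexManifoldType W)
    (A : set M) (f : M -> N) :
  (forall x, A x -> exists2 g : M -> N, holo [set x] g &
     \forall y \near x, g y = f y) -> holo A f.
Proof.
move=> hf x Ax; have [g hg gf] := hf x Ax; have [cg dg] := hg x erefl.
have gfx : g x = f x := nbhs_singleton gf.
split.
  have : g @ x --> f x by rewrite -gfx.
  by apply: cvg_trans; exact: near_eq_cvg.
move=> c d ac ad cx dx.
have nr : \forall p \near c x, (d \o g \o cinv c) p = (d \o f \o cinv c) p.
  by apply: filterS (near_cinv ac cx gf) => p /= ->.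
have [|//] := near_differentiable nr.
by apply: dg; rewrite ?gfx.
Qed.

Lemma holo_sub (M : complexManifoldType V) (N : complexManifoldType W)
    (A A' : set M) (f : M -> N) : A `<=` A' -> holo A' f -> holo A f.
Proof. by move=> AA hf x /AA /hf. Qed.

End Holomorphic.

(** * The groupoid of Higgs bundle isomorphisms *)

Section BundleMaps.
Context {R : realType} {X : complexManifoldType (R[i]%C : normedModType R[i]%C)}.
Context {n : nat} {G : complexLieGroupType R n}.

Lemma holo_invg (A : set X) (h : X -> G) : holo A h -> holo A (fun x => (h x)^-1).
Proof. by move=> hh; apply: (holo_comp hh (@invg_holo R n G)). Qed.

Lemma bact_inj (E : gBundle X G) (e : E) : injective (bact e).
Proof.
move=> g h egh; have [k [_ u]] := bact_free_trans (esym (bproj_act e g)).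
by rewrite -(u g erefl) -(u h egh).
Qed.

Lemma bproj_surj (E : gBundle X G) (x : X) : exists e : E, bproj e = x.
Proof.
have [U [s [hs Ux]]] := local_sec_cover E x.
by exists (s x); rewrite (local_sec_proj hs).
Qed.

Lemma local_sec_nbhs (E : gBundle X G) U (s : X -> E) x :
  local_sec U s -> U x -> nbhs x U.
Proof.
by move=> hs Ux; apply: open_nbhs_nbhs; split=> //; exact: (local_sec_open hs).
Qed.

(** Since [G] acts freely, the local transition functions are forced at each point, so they glue to
    a single one over the intersection of [U] and [U']. *)
Lemma bundle_holo_near (E E' : gBundle X G) (F : E -> E') :
  (forall e, bproj (F e) = bproj e) ->
  (forall U s U' s' x, local_sec U s -> local_sec U' s' -> U x -> U' x ->
     exists2 h : X -> G, holo [set x] h &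
       \forall y \near x, F (s y) = bact (s' y) (h y)) ->
  bundle_holo id F.
Proof.
move=> pF hF U s U' s' hs hs'.
(* The default [1] can only be reached outside the intersection of [U] and [U']. *)
pose h y : G := xget 1 [set g | F (s y) = bact (s' y) g].
have hP y : U y -> U' y -> F (s y) = bact (s' y) (h y).
  move=> Uy U'y; rewrite /h; case: xgetP => // none.
  have [|g [eg _]] := @bact_free_trans _ _ _ _ E' (s' y) (F (s y)).
    by rewrite pF (local_sec_proj hs) // (local_sec_proj hs').
  by have /none := eg.
exists h => //; apply: holo_near => x [Ux U'x].
have [k hk ek] := hF _ _ _ _ _ hs hs' Ux U'x; exists k => //.
apply: filterS3 (local_sec_nbhs hs Ux) (local_sec_nbhs hs' U'x) ek => y Uy U'y ek.
by apply: (@bact_inj E' (s' y)); rewrite -ek hP.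
Qed.

Implicit Types H : higgsBundle X G.

(** A section [s0] of the middle bundle exists only locally, so holomorphy is checked near each
    point, with transition function [h2 * h1]. *)
Lemma is_higgs_iso_comp H H' H'' (F : H -> H') (F' : H' -> H'') :
  is_higgs_iso F -> is_higgs_iso F' -> is_higgs_iso (F' \o F).
Proof.
move=> [pF aF hF fF] [pF' aF' hF' fF']; split.
- by move=> e; rewrite /= pF' pF.
- by move=> e g; rewrite /= aF aF'.
- apply: bundle_holo_near => [e|U s U' s' x hs hs' Ux U'x].
    by rewrite /= pF' pF.
  have [U0 [s0 [hs0 U0x]]] := local_sec_cover H' x.
  have [h1 hh1 e1] := hF _ _ _ _ hs hs0; have [h2 hh2 e2] := hF' _ _ _ _ hs0 hs'.
  exists (fun y => h2 y * h1 y).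
    by apply: holo_mulg; [apply: holo_sub hh2|apply: holo_sub hh1] => y ->.
  apply: filterS3 (local_sec_nbhs hs Ux) (local_sec_nbhs hs0 U0x)
    (local_sec_nbhs hs' U'x).
  by move=> y Uy U0y U'y /=; rewrite e1 // aF' e2 // bactM.
- by move=> e; rewrite /= fF' fF.
Qed.

Lemma is_higgs_iso_inj H H' (F : H -> H') : is_higgs_iso F -> injective F.
Proof.
move=> [pF aF _ _] e e' ee'.
have [|g [eg _]] := @bact_free_trans _ _ _ _ H e e'.
  by rewrite -!pF ee'.
move: ee'; rewrite eg aF -{1}[F e]bact1 => /bact_inj <-.
by rewrite bact1.
Qed.

(** [F] is onto because [G] is transitive on fibres; the inverse map has the pointwise inverse
    transition functions. *)
Lemma is_higgs_iso_inv H H' (F : H -> H') : is_higgs_iso F ->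
  exists F', [/\ cancel F F', cancel F' F & is_higgs_iso F'].
Proof.
move=> iF; have Finj := is_higgs_iso_inj iF; have [pF aF hF fF] := iF.
have surj e' : exists e, F e = e'.
  have [e pe] := bproj_surj H (bproj e').
  have [|g [eg _]] := @bact_free_trans _ _ _ _ H' (F e) e'; first by rewrite pF.
  by exists (bact e g); rewrite aF.
pose F' e' := projT1 (cid (surj e')).
have FK : cancel F' F by move=> e'; rewrite /F'; case: cid.
have KF : cancel F F' by move=> e; apply: Finj; rewrite FK.
exists F'; split=> //; split.
- by move=> e; rewrite -pF FK.
- by move=> e g; apply: Finj; rewrite aF !FK.
- move=> U s U' s' hs hs'; have [h hh e] := hF _ _ _ _ hs' hs.
  exists (fun x => (h x)^-1).
    by apply: holo_invg; apply: holo_sub hh => x [].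
  move=> x Ux U'x; apply: Finj.
  by rewrite FK aF e // -bactM mulgV bact1.
- by move=> e; rewrite -fF FK.
Qed.

Lemma higgs_iso_trans H H' H'' :
  higgs_iso H H' -> higgs_iso H' H'' -> higgs_iso H H''.
Proof. by move=> [F iF] [F' iF']; exists (F' \o F); exact: is_higgs_iso_comp. Qed.

Lemma higgs_iso_sym H H' : higgs_iso H H' -> higgs_iso H' H.
Proof. by move=> [F /is_higgs_iso_inv[F' [_ _ iF']]]; exists F'. Qed.

Lemma mclass_iso K B (m : moduli K B) H H' :
  mclass m H -> mclass m H' <-> higgs_iso H H'.
Proof.
have [H0 _ ->] := mclassP m => /= HH0; split; last exact: higgs_iso_trans.
by apply: higgs_iso_trans; exact: higgs_iso_sym.
Qed.

End BundleMaps.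

(** * Functoriality of the action and change of lift *)

Section Action.
Context {R : realType} {X : complexManifoldType (R[i]%C : normedModType R[i]%C)}.
Context {n : nat} {G : complexLieGroupType R n}.
Implicit Types (H : higgsBundle X G) (psi : lieAut G).

(** The chain rule, evaluated on the generator [1] of the one-dimensional tangent space. *)
Lemma cotr_map_comp (f g : holAut X) (x : X) :
  cotr_map (f \o g) x = (cotr_map g x * cotr_map f (g x))%R.
Proof.
have [cg dg] := @ha_holo _ _ g x I; have [_ df] := @ha_holo _ _ f (g x) I.
have at0 y := chart_at_atlas (y : X); have dom0 y := chart_at_dom (y : X).
have [||_] := @chart_comp _ _ _ X X _ (chart_at x) (chart_at (g x)) g
  (chart_at (f (g x)) \o f) x (at0 _) (at0 _) (dom0 _) (dom0 _) cg.
- exact: dg.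
- exact: df.
move=> /(congr1 (fun F => F (1 : R[i]%C)%R)) e; apply: etrans e _.
exact: (linear_scalar ('d (chart_at (f (g x)) \o f \o cinv (chart_at (g x))) _)).
Qed.

Lemma d1_inv_comp psi psi' psi'' v : (forall x, psi'' x = psi (psi' x)) ->
  d1 (lieAut_inv psi'') v = d1 (lieAut_inv psi') (d1 (lieAut_inv psi) v) :> 'rV_n.
Proof.
move=> h; rewrite -[RHS](@d1_comp _ _ _ (lieAut_inv psi') (lieAut_inv psi)).
- congr (d1 _ v); apply/funext => x /=.
  by apply: (can_inj (la_funK psi'')); rewrite la_invK h !la_invK.
- exact: la_holo.
- exact: la_holo.
- exact: la_one.
- exact: la_one.
Qed.

Context {Gamma : finGroupType}.
Variables (eta : Gamma -> holAut X) (mu : Gamma -> R[i]%C).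
Local Notation act := (higgs_act_by eta mu).

(** The action keeps the total space, so [F] itself serves. On the new bundle [x] acts as [psi x]
    did, hence the factor [lieAut_inv psi] in the transition functions. *)
Lemma act_is_higgs_iso g psi H H' (F : H -> H') : is_higgs_iso F ->
  @is_higgs_iso _ _ _ _ (act g psi H) (act g psi H') F.
Proof.
move=> [pF aF hF fF]; split.
- by move=> e; rewrite -[LHS]/(ha_inv (eta g) (bproj (F e))) pF.
- move=> e x; exact: aF.
- move=> U s U' s' [U0 [s0 [hs -> ->]]] [U1 [s1 [hs' -> ->]]].
  have [h hh e] := hF _ _ _ _ hs hs'; exists (lieAut_inv psi \o h \o eta g).
    apply: (@holo_comp _ _ _ _ X X G _ (U0 `&` U1) (eta g)) => //; last first.
      by apply: (holo_comp hh (@la_holo _ _ _ (lieAut_inv psi))).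
    by apply: holo_sub (@ha_holo _ _ (eta g)).
  move=> x /= Ux U'x; rewrite e //.
  by rewrite /ext_act /= la_invK.
- move=> e; rewrite -[LHS]/(mu g *: (cotr_map (eta g) (ha_inv (eta g)
      (bproj (F e))) *: d1 (lieAut_inv psi) (higgs (F e))))%R.
  by rewrite pF fF.
Qed.

(** Both sides have the total space of [H], with [G] acting through [psi''], so the identity is an
    isomorphism; the fields agree by the chain rules for [cotr_map] and [d1]. *)
Lemma act_mul_is_higgs_iso g g' psi psi' psi'' H :
  (forall x, eta (g * g') x = eta g (eta g' x)) ->
  mu (g * g') = (mu g * mu g')%R ->
  (forall x, psi'' x = psi (psi' x)) ->
  @is_higgs_iso _ _ _ _ (act (g * g') psi'' H) (act g' psi' (act g psi H)) id.
Proof.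
move=> heta hmu hpsi.
have heta' x : ha_inv (eta (g * g')) x = ha_inv (eta g') (ha_inv (eta g) x).
  by apply: (can_inj (ha_funK (eta (g * g')))); rewrite ha_invK heta !ha_invK.
split.
- by move=> e; rewrite -[RHS]/(ha_inv _ _) heta'.
- move=> e x; rewrite -[LHS]/(bact (e : H) (psi'' x)).
  by rewrite -[RHS]/(bact (e : H) (psi (psi' x))) hpsi.
- move=> U s U' s' [U0 [s0 [hs -> ->]]] [U1 [_ [[U2 [s1 [hs' -> ->]]] -> ->]]].
  have [h hh e] := @local_sec_holo _ _ _ _ H _ _ _ _ hs' hs.
  exists (lieAut_inv psi'' \o h \o eta (g * g')).
    apply: (@holo_comp _ _ _ _ X X G _ (U2 `&` U0) (eta (g * g'))) => //.
    + by apply: holo_sub (@ha_holo _ _ (eta (g * g'))).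
    + by apply: (holo_comp hh (@la_holo _ _ _ (lieAut_inv psi''))).
    + by move=> x [/= ? ?]; rewrite heta; split=> //; rewrite -heta.
  move=> x /= U0x U2x; rewrite -heta in U2x *; rewrite e //.
  rewrite -[RHS]/(bact (s1 (eta (g * g') x) : H)
    (psi (psi' (la_inv psi'' (h (eta (g * g') x)))))).
  by rewrite -hpsi la_invK.
- move=> e.
  rewrite -[RHS]/(mu (g * g') *: (cotr_map (eta (g * g')) (ha_inv (eta (g * g'))
      (bproj (e : H))) *: d1 (lieAut_inv psi'') (higgs (e : H))))%R.
  rewrite -[LHS]/(mu g' *: (cotr_map (eta g') (ha_inv (eta g') (ha_inv (eta g)
      (bproj (e : H)))) *: d1 (lieAut_inv psi') (mu g *: (cotr_map (eta g)
      (ha_inv (eta g) (bproj (e : H))) *: d1 (lieAut_inv psi) (higgs (e : H))))))%R.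
  rewrite (d1_inv_comp _ hpsi) heta' hmu.
  rewrite (_ : (eta (g * g') : X -> X) = eta g \o eta g'); last exact/funext.
  rewrite cotr_map_comp ha_invK.
  rewrite -[d1 (lieAut_inv psi') _]/('d _ _ _) !GRing.linearZ /=.
  by rewrite !GRing.scalerA -GRing.mulrA GRing.mulrACA.
Qed.

(** Right translation by [psi k^-1] absorbs the inner automorphism between the two lifts, because
    [psi x * psi k^-1 = psi k^-1 * psi' x]. *)
Lemma act_lift_is_higgs_iso g psi psi' k H :
  (forall x, psi' x = psi (k * x * k^-1)) ->
  @is_higgs_iso _ _ _ _ (act g psi H) (act g psi' H)
    (fun e => bact (e : H) (psi k^-1)).
Proof.
move=> hpsi; split.
- by move=> e; rewrite -[LHS]/(ha_inv (eta g) (bproj (bact (e : H) _))) bproj_act.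
- move=> e x; rewrite -[LHS]/(bact (bact (e : H) (psi x)) (psi k^-1)).
  rewrite -[RHS]/(bact (bact (e : H) (psi k^-1)) (psi' x)) -!bactM -la_mul !hpsi.
  by rewrite -la_mul !mulgA mulVg mul1g.
- move=> U s U' s' [U0 [s0 [hs -> ->]]] [U1 [s1 [hs' -> ->]]].
  have [h hh e] := @local_sec_holo _ _ _ _ H _ _ _ _ hs' hs.
  exists (lieAut_inv psi' \o (fun x => h x * psi k^-1) \o eta g).
    apply: (@holo_comp _ _ _ _ X X G _ (U1 `&` U0) (eta g)).
    + by apply: holo_sub (@ha_holo _ _ (eta g)).
    + apply: (@holo_comp _ _ _ _ X G G _ setT) => //; last exact: la_holo.
      by apply: holo_mulg => //; exact: holo_cst.
    + by move=> x [/= ? ?].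
  move=> x /= U0x U1x; rewrite e //.
  rewrite -[RHS]/(bact (s1 (eta g x) : H)
    (psi' (la_inv psi' (h (eta g x) * psi k^-1)))).
  by rewrite la_invK bactM.
- move=> e; set t := psi k^-1.
  rewrite -[LHS]/(mu g *: (cotr_map (eta g) (ha_inv (eta g) (bproj (bact (e : H)
     t))) *: d1 (lieAut_inv psi') (higgs (bact (e : H) t))))%R.
  rewrite bproj_act higgs_act.
  rewrite -[RHS]/(mu g *: (cotr_map (eta g) (ha_inv (eta g) (bproj (e : H))) *:
    d1 (lieAut_inv psi) (higgs (e : H))))%R.
  congr (_ *: (_ *: _))%R; rewrite /t la_invg invgK.
  (* Conjugation by [psi k] followed by the inverse of [psi'] is the inverse of [psi]. *)
  rewrite -[LHS](@d1_comp _ _ _ (lieAut_inv psi')).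
  + congr (d1 _ (higgs (e : H))); apply/funext => x /=.
    apply: (can_inj (la_funK psi')).
    by rewrite la_invK hpsi !la_mul la_invg la_invK.
  + exact: la_holo.
  + exact: holo_conj.
  + exact: la_one.
  + by rewrite mulg1 mulgV.
Qed.

End Action.

(** * Stability implies polystability for restricted tests *)

Section ZeroDegree.
Context {R : realType} {X : complexManifoldType (R[i]%C : normedModType R[i]%C)}.
Context {n : nat} {G : complexLieGroupType R n}.
Local Notation lie := 'rV[R[i]%C]_n.

Lemma one_param0 : @one_param R n G 0%R (fun=> 1).
Proof.
split; first exact: cst_continuous.
  by move=> s t; rewrite mulg1.
rewrite (_ : (fun _ => _) = cst 0%R); first exact: cvg_cst.
by apply/funext => t; rewrite GRing.subrr GRing.scaler0.
Qed.

Lemma P_0 : @P_ R n G 0%R = setT.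
Proof.
rewrite predeqE => g; split=> // _; exists (fun=> 1); first exact: one_param0.
exists [set g]; first exact: compact_set1.
by near=> t; rewrite /= mul1g invg1 mulg1.
Unshelve. all: by end_near. Qed.

Lemma L_0 : @L_ R n G 0%R = setT.
Proof.
rewrite predeqE => g; split=> // _; exists (fun=> 1); first exact: one_param0.
rewrite (_ : (fun _ => _) = cst g); first exact: cvg_cst.
by apply/funext => t; rewrite mul1g invg1 mulg1.
Qed.

Variables (K : set G) (B : lie -> lie -> R[i]%C).
Hypothesis hB : invariant_form G B.

(** If a degree exists, its integrand [B 0 _] vanishes; otherwise [degree] takes its default value,
    which is also [0]. *)
Lemma degree0 (E : gBundle X G) (S : set E) : degree K B S 0%R = 0%R.
Proof.
have B0 v : B 0%R v = 0%R.
  have [_ lin _ _] := hB.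
  (* Linearity at [-1 *: 0 + 0] gives [B 0 v = - B 0 v + B 0 v]. *)
  have := lin (-1)%R 0%R 0%R v.
  by rewrite GRing.scaler0 GRing.addr0 GRing.mulN1r GRing.addNr.
rewrite /degree; case: xgetP => // d -> [F [A [_ _ _ [N [c [U [f [D [_ _ ->]]]]]]]]].
rewrite big1 ?GRing.mulr0 // => j _.
rewrite /cintegral.
under [X in (Rintegral _ _ X +i* _)%C]eq_fun do rewrite B0.
under [X in (_ +i* Rintegral _ _ X)%C]eq_fun do rewrite B0.
by rewrite /= /Rintegral !integral0.
Qed.

Lemma stable_for_polystable (H : higgsBundle X G) (I : set lie) (J : set (set H)) :
  stable K B H -> polystable_for K B I J.
Proof.
move=> st.
(* Restricted tests are among those of [stable], so degree [0] forces [s = 0]. *)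
have sP s S : tested K I J s S -> s != 0%R -> (0 < degree K B S s)%R.
  by move=> [ks _ rS _ hS] s0; apply: st.
split=> [s S tS|s S tS dS].
  have [->|/(sP _ _ tS)/Order.POrderTheory.ltW//] := eqVneq s 0%R.
  by rewrite degree0.
have [s0|/(sP _ _ tS)] := eqVneq s 0%R; last by rewrite dS Order.POrderTheory.ltxx.
move: tS; rewrite s0 => -[_ _]; rewrite P_0 => rS JS hS.
by exists S; rewrite L_0; split.
Qed.

End ZeroDegree.

(** * Twisted actions as families of isomorphisms *)

Section Twisted.
Context {R : realType} {X : complexManifoldType (R[i]%C : normedModType R[i]%C)}.
Context {n : nat} {G : complexLieGroupType R n} {Gamma : finGroupType}.
Variables (eta : Gamma -> holAut X) (a : Gamma -> outG G) (mu : Gamma -> R[i]%C).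
Variable theta : Gamma -> lieAut G.
Implicit Types H : higgsBundle X G.
Local Notation act g H := (higgs_act_by eta mu g (theta g) H).

(** [act g H] has the total space of [H], so an isomorphism from [act g H] to [H'] can be typed as a
    map [H -> H']. *)
Definition act_iso g H H' (F : H -> H') := @is_higgs_iso _ _ _ _ (act g H) H' F.

(** A map over the identity out of a pullback along [eta g] is a map over the inverse of [eta g]:
    local sections change by composition with [eta g], and [x] acts on [act g H] as [theta g x] does
    on [H]. *)
Lemma act_isoE g H (F : H -> H) : act_iso g F <->
  [/\ forall e, bproj (F e) = ha_inv (eta g) (bproj e),
      bundle_holo (ha_inv (eta g)) F,
      forall e x, F (bact e x) = bact (F e) (lieAut_inv (theta g) x) &
      forall e, higgs (F e) = (mu g *: (cotr_map (eta g) (bproj (F e)) *: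
                            d1 (lieAut_inv (theta g)) (higgs e)))%R].
Proof.
split=> -[pF aF hF fF]; split.
- exact: pF.
- move=> U s U' s' hs hs'.
  have hs1 : @local_sec _ _ _ _ (act g H) (eta g @^-1` U) (s \o eta g).
    by exists U, s.
  have [h hh e] := hF _ _ _ _ hs1 hs'.
  exists (h \o ha_inv (eta g)).
    apply: (@holo_comp _ _ _ _ X X G _ _ _ _ _ hh) => [|x [Ux U'x]].
      by apply: holo_sub (@ha_inv_holo _ _ (eta g)).
    by split=> //=; rewrite ha_invK.
  by move=> x Ux U'x; rewrite /= -e /= ?ha_invK.
- move=> e x; rewrite -aF.
  by rewrite -[RHS]/(F (bact (e : H) (theta g (la_inv (theta g) x)))) la_invK.
- by move=> e; rewrite fF pF.
- exact: pF.
- move=> e x; rewrite -[LHS]/(F (bact (e : H) (theta g x))) hF.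
  by rewrite /= la_funK.
- move=> U s U' s' [U0 [s0 [hs -> ->]]] hs'.
  have [h hh e] := aF _ _ _ _ hs hs'.
  exists (h \o eta g).
    apply: (@holo_comp _ _ _ _ X X G _ _ _ _ _ hh) => [|x [Ux U'x]].
      by apply: holo_sub (@ha_holo _ _ (eta g)).
    by split=> //=; rewrite ha_funK.
  by move=> x Ux U'x; rewrite /= e /= ?ha_funK.
- by move=> e; rewrite fF pF.
Qed.

Lemma twisted_actionP c H (b : Gamma -> H -> H) :
  twisted_action eta theta c b /\ twisted_higgs eta mu theta b <->
  (forall g, act_iso g (b g)) /\
  forall g g' e, b g' (b g e) = b (g * g') (bact e (c g g')).
Proof.
split=> [[[pb hb ab cb] fb]|[ib cb]].
  split; last exact: cb.
  move=> g; apply/act_isoE; split.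
  - exact: pb.
  - exact: hb.
  - exact: ab.
  - exact: fb.
split; [split|].
- by move=> g; have /act_isoE[p _ _ _] := ib g; exact: p.
- by move=> g; have /act_isoE[_ h _ _] := ib g; exact: h.
- by move=> g; have /act_isoE[_ _ e _] := ib g; exact: e.
- exact: cb.
- by move=> g; have /act_isoE[_ _ _ f] := ib g; exact: f.
Qed.

End Twisted.

(** * Central elements of [G] *)

Section Centre.
Context {R : realType} {n : nat} {G : complexLieGroupType R n}.
Implicit Types psi : lieAut G.

Lemma lie_centerM (x y : G) : lie_center x -> lie_center y -> lie_center (x * y).
Proof. by move=> zx zy g; rewrite -mulgA zy !mulgA zx. Qed.

Lemma lie_centerV (x : G) : lie_center x -> lie_center x^-1.
Proof. by move=> zx g; apply: (mulgI x); rewrite mulVKg mulgA zx mulgK. Qed.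

(** Carries central factors to the right, which brings cochain identities to a common form. *)
Lemma lie_centerAC (z : G) : lie_center z -> forall x y, x * z * y = x * y * z.
Proof. by move=> zz x y; rewrite -!mulgA zz. Qed.

Lemma lie_center_aut psi (x : G) : lie_center x -> lie_center (psi x).
Proof. by move=> zx g; rewrite -(la_invK psi g) -!la_mul zx. Qed.

End Centre.

(** * Lifts, cohomology and composition of twisted isomorphisms *)

Section Fixed.
Context {R : realType} {X : complexManifoldType (R[i]%C : normedModType R[i]%C)}.
Context {n : nat} {G : complexLieGroupType R n} {Gamma : finGroupType}.
Variables (eta : Gamma -> holAut X) (a : Gamma -> outG G) (mu : Gamma -> R[i]%C).
Variable theta : Gamma -> lieAut G.
Implicit Types H : higgsBundle X G.

Lemma out_setE g psi psi' : out_set (a g) psi -> out_set (a g) psi' ->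
  exists k, forall x, psi x = psi' (k * x * k^-1).
Proof.
have [f ->] := out_setP (a g) => -[h hE] [h' h'E].
exists (h'^-1 * h) => x; rewrite hE h'E invMg invgK !mulgA mulgV mul1g.
by rewrite mulgK.
Qed.

(** Inner automorphisms fix the centre, so identities required for every lift of [a g] may be
    checked on [theta g]. *)
Lemma out_set_center g psi psi' z : out_set (a g) psi -> out_set (a g) psi' ->
  lie_center z -> psi z = psi' z.
Proof.
by move=> hpsi hpsi' zz; have [k ->] := out_setE hpsi hpsi'; rewrite -zz mulgK.
Qed.

Lemma cohomologous_sym c c' : cohomologous a c c' -> cohomologous a c' c.
Proof.
move=> [beta zb hb]; exists (fun g => (beta g)^-1) => [g|g g' psi hpsi].
  exact: lie_centerV.
rewrite (hb _ _ _ hpsi) la_invg invgK !(lie_centerAC (lie_centerV (zb (g * g')))).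
by rewrite mulgK (lie_centerAC (zb g)) !mulgK.
Qed.

Lemma cohomologous_trans c c' c'' :
  cohomologous a c c' -> cohomologous a c' c'' -> cohomologous a c c''.
Proof.
move=> [beta zb hb] [beta' zb' hb']; exists (fun g => beta g * beta' g) => [g|].
  exact: lie_centerM.
move=> g g' psi hpsi; rewrite (hb' _ _ _ hpsi) (hb _ _ _ hpsi) la_mul invMg.
by rewrite !(lie_centerAC (lie_centerV (zb (g * g')))) !mulgA (lie_centerAC (zb g)).
Qed.

Lemma H2_class_eq c c' : cohomologous a c c' -> H2_class a c = H2_class a c'.
Proof.
move=> cc'; rewrite predeqE => c''; split=> -[zc'' h]; split=> //.
  exact: cohomologous_trans (cohomologous_sym cc') h.
exact: cohomologous_trans cc' h.
Qed.

Hypothesis hGamma : finite_subgroup eta a mu.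
Hypothesis htheta : is_lift a theta.
Local Notation act g psi H := (higgs_act_by eta mu g psi H).
Local Notation act_iso := (act_iso eta mu theta).

(** The composite [H.(g * g') -> (H.g).g' -> H'.g' -> H''], whose first arrow is the identity on
    total spaces. *)
Lemma act_iso_mul g g' H H' H'' (F : H -> H') (F' : H' -> H'') :
  act_iso g F -> act_iso g' F' -> act_iso (g * g') (F' \o F).
Proof.
have [heta _ [_ hmu] _] := hGamma; have [_ hth] := htheta.
move=> iF iF'.
have i1 := act_mul_is_higgs_iso H (heta g g') (hmu g g') (hth g g').
have i2 := act_is_higgs_iso eta mu g' (theta g') iF.
exact: (is_higgs_iso_comp i1 (is_higgs_iso_comp i2 iF')).
Qed.

Lemma act_iso_comp g H0 H H' H'' (F0 : H0 -> H) (F : H -> H') (F' : H' -> H'') :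
  is_higgs_iso F0 -> act_iso g F -> is_higgs_iso F' -> act_iso g (F' \o F \o F0).
Proof.
move=> iF0 iF iF'.
exact: (is_higgs_iso_comp (act_is_higgs_iso eta mu g (theta g) iF0)
  (is_higgs_iso_comp iF iF')).
Qed.

Lemma act_iso_inj g H H' (F : H -> H') : act_iso g F -> injective F.
Proof. exact: is_higgs_iso_inj. Qed.

Lemma act_iso_act g H (F : H -> H) e x : act_iso g F ->
  F (bact e (theta g x)) = bact (F e) x.
Proof. by move=> /act_isoE[_ _ -> _]; rewrite /= la_funK. Qed.

(* [F] itself is an automorphism of [H], because [F \o F] and [F] are both
   isomorphisms from [H.1] to [H], so [id = F^-1 \o F] is one too. *)
Lemma act_iso1 H (F : H -> H) : act_iso 1 F -> act_iso 1 (id : H -> H).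
Proof.
move=> iF; have [F' [_ F'K iF']] := is_higgs_iso_inv iF.
have iFF := act_iso_mul iF iF; rewrite mulg1 in iFF.
have iF1 : is_higgs_iso (F : H -> H).
  rewrite (_ : F = (F \o F) \o F'); first exact: (is_higgs_iso_comp iF' iFF).
  by apply/funext => e /=; rewrite F'K.
have [F1 [FK _ iF1']] := is_higgs_iso_inv iF1.
rewrite (_ : id = F1 \o F); first exact: (is_higgs_iso_comp iF iF1').
by apply/funext => e /=; rewrite FK.
Qed.

(** [F'] after the inverse of [F] is an automorphism of the simple [H'], hence central. *)
Lemma act_iso_ratio g H H' (F F' : H -> H') : simple_higgs H' ->
  act_iso g F -> act_iso g F' ->
  exists2 z : G, lie_center z & forall e, F' e = bact (F e) z.
Proof.
move=> simH' iF iF'; have [F1 [FK _ iF1]] := is_higgs_iso_inv iF.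
have [z zz hz] := (simH' _).1 (is_higgs_iso_comp iF1 iF').
by exists z => // e; rewrite -hz /= FK.
Qed.

(** * Fixed points, cocycles and disjointness *)

Section Stability.
Variables (K : set G) (B : 'rV[R[i]%C]_n -> 'rV[R[i]%C]_n -> R[i]%C).
Hypothesis hB : invariant_form G B.
Local Notation M_tilde := (@moduli_twisted R X n G K B Gamma eta mu theta).
Local Notation M_star := (@moduli_stable_simple R X n G K B).
Local Notation M_fixed := (@moduli_fixed R X n G K B Gamma eta a mu).

(** [b g] identifies [H.g], formed with [theta g], with [H]; it remains to change the lift to [psi]
    and the representative to [H']. *)
Lemma moduli_twisted_fixed c : M_tilde c `<=` M_fixed.
Proof.
move=> m [H [b [mH tb hb _]]] g psi H' hpsi mH'.
have [ib _] := (twisted_actionP _ _ _ _ _).1 (conj tb hb).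
apply/(mclass_iso _ mH).
have [F iF] := (mclass_iso H' mH).1 mH'.
have [k hk] := out_setE hpsi (htheta.1 g).
apply: (@higgs_iso_trans _ _ _ _ H (act g (theta g) H)).
  exact: (higgs_iso_sym (ex_intro _ (b g : act g (theta g) H -> H) (ib g))).
apply: (@higgs_iso_trans _ _ _ _ _ (act g psi H)).
  exact: (ex_intro _ _ (act_lift_is_higgs_iso eta mu g H hk)).
exact: (ex_intro _ _ (act_is_higgs_iso eta mu g psi iF)).
Qed.

Lemma simple_cocycle H (b : Gamma -> H -> H) (x0 : X) :
  simple_higgs H -> (forall g, act_iso g (b g)) -> b 1 = id ->
  exists2 c, Z2 a c & forall g g' e, b g' (b g e) = b (g * g') (bact e (c g g')).
Proof.
move=> simH ib b1.
have binj g := act_iso_inj (ib g).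
have bact_b g e x : bact (b g e) x = b g (bact e (theta g x)).
  by rewrite act_iso_act.
have hc g g' : exists2 z : G, lie_center z &
    forall e, b g' (b g e) = b (g * g') (bact e z).
  have [z zz hz] := act_iso_ratio simH (ib (g * g')) (act_iso_mul (ib g) (ib g')).
  (* The central ratio appears outside [b (g * g')]; moving it inside applies [theta (g * g')]. *)
  exists (theta (g * g') z); first exact: lie_center_aut.
  by move=> e; rewrite -bact_b -hz.
pose c g g' := s2val (cid2 (hc g g')).
have cz g g' : lie_center (c g g') by rewrite /c; case: cid2.
have cE g g' e : b g' (b g e) = b (g * g') (bact e (c g g')).
  by rewrite /c; case: cid2.
(* Identities in [G] are tested on one point [e]: the action is free and each [b g] is injective. *)
have [e _] := bproj_surj H x0.
exists c => //; split=> // [g|g g' g'' psi hpsi].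
  split; apply: (@bact_inj _ _ _ _ H e); apply: (binj g); rewrite bact1.
    by rewrite -[X in b X (bact _ _)]mul1g -cE b1.
  by rewrite -[X in b X (bact _ _)]mulg1 -cE b1.
(* Associativity: both sides of the cocycle condition come from [b g'' (b g' (b g e))]. *)
rewrite (out_set_center hpsi (htheta.1 g)) // [RHS](cz (g * g') g'').
apply: (@bact_inj _ _ _ _ H e); apply: (binj (g * (g' * g''))).
rewrite [bact e (theta _ _ * _)]bactM -cE -bact_b.
by rewrite -cE mulgA bactM -cE -cE.
Qed.

Lemma stable_simple_fixed_twisted (x0 : X) :
  M_star `&` M_fixed `<=` \bigcup_(c in Z2 a) M_tilde c.
Proof.
move=> m [[H [mH stH simH]] fixm].
have hF g : exists F : H -> H, act_iso g F.
  have /(mclass_iso _ mH) := fixm _ _ _ (htheta.1 g) mH.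
  exact: higgs_iso_sym.
have [F iF] := choice hF.
(* Taking the identity at [1] makes the resulting cocycle normalised. *)
pose b g := if g == 1 then id else F g.
have ib g : act_iso g (b g).
  rewrite /b; case: eqVneq => [->|_]; last exact: iF.
  exact: act_iso1 (iF 1).
have [|c Zc bc] := simple_cocycle x0 simH ib; first by rewrite /b eqxx.
exists c => //; exists H, b.
have [tb hb] := (twisted_actionP eta mu theta c b).2 (conj ib bc).
split=> //; exact: stable_for_polystable.
Qed.

(** Conjugation by the isomorphism preserves [c], so structures on isomorphic Higgs bundles can be
    compared on one of them. *)
Lemma twisted_transport c H H' (b : Gamma -> H -> H) :
  higgs_iso H H' -> twisted_action eta theta c b -> twisted_higgs eta mu theta b ->
  exists2 b' : Gamma -> H' -> H', forall g, act_iso g (b' g) &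
    forall g g' e, b' g' (b' g e) = b' (g * g') (bact e (c g g')).
Proof.
move=> [F iF] tb hb; have [ib cb] := (twisted_actionP _ _ _ _ _).1 (conj tb hb).
have [F' [FK F'K iF']] := is_higgs_iso_inv iF.
exists (fun g => F \o b g \o F') => [g|g g' e /=].
  exact: act_iso_comp iF' (ib g) iF.
by have [_ aF' _ _] := iF'; rewrite FK cb aF'.
Qed.

(** The cochain [beta] is the central ratio of [b' g] to [b g], placed inside [b g]. *)
Lemma twisted_cohomologous c c' H (b b' : Gamma -> H -> H) (x0 : X) :
  simple_higgs H -> Z2 a c ->
  (forall g, act_iso g (b g)) -> (forall g, act_iso g (b' g)) ->
  (forall g g' e, b g' (b g e) = b (g * g') (bact e (c g g'))) ->
  (forall g g' e, b' g' (b' g e) = b' (g * g') (bact e (c' g g'))) ->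
  cohomologous a c c'.
Proof.
move=> simH [zc _ _] ib ib' bc bc'.
have bact_b g e x : bact (b g e) x = b g (bact e (theta g x)).
  by rewrite act_iso_act.
have hbeta g : exists2 z : G, lie_center z & forall e, b' g e = b g (bact e z).
  have [z zz hz] := act_iso_ratio simH (ib g) (ib' g).
  by exists (theta g z) => [|e]; [exact: lie_center_aut|rewrite hz bact_b].
pose beta g := s2val (cid2 (hbeta g)).
have zbeta g : lie_center (beta g) by rewrite /beta; case: cid2.
have betaE g e : b' g e = b g (bact e (beta g)) by rewrite /beta; case: cid2.
exists beta => // g g' psi hpsi; rewrite (out_set_center hpsi (htheta.1 g)) //.
apply: (mulIg (beta (g * g'))); rewrite mulgKV.
have [e _] := bproj_surj H x0.
apply: (@bact_inj _ _ _ _ H e); apply: (act_iso_inj (ib (g * g'))).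
(* The left side becomes [b' g' (b' g e)]; rewriting it through [b] and [beta] produces [c g g']
   and, when [beta g'] passes inside [b g], the twist by [theta g]. *)
rewrite [in LHS]bactM -betaE -bc' !betaE bact_b bc -!bactM.
by rewrite (zbeta g) zc.
Qed.

(** A common point yields two twisted structures, which are both transported to its simple
    representative [H0] and compared there. *)
Lemma twisted_disjoint c c' (x0 : X) : Z2 a c -> H2_class a c <> H2_class a c' ->
  (M_star `&` M_tilde c) `&` (M_star `&` M_tilde c') = set0.
Proof.
move=> Zc cc'; rewrite -subset0.
move=> m [[[H0 [mH0 _ simH0]] [H [b [mH tb hb _]]]] [_ [H' [b' [mH' tb' hb' _]]]]].
have isoH0 H1 : mclass m H1 -> higgs_iso H1 H0.
  by move=> mH1; apply/(mclass_iso _ mH1).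
have [b1 ib1 cb1] := twisted_transport (isoH0 _ mH) tb hb.
have [b2 ib2 cb2] := twisted_transport (isoH0 _ mH') tb' hb'.
apply: cc'; apply: H2_class_eq.
exact: (twisted_cohomologous x0 simH0 Zc ib1 ib2 cb1 cb2).
Qed.

End Stability.
End Fixed.

Local Close Scope group_scope.

Theorem theoremA (R : realType)
    (X : complexManifoldType (R[i]%C : normedModType R[i]%C))
    (n : nat) (G : complexLieGroupType R n)
    (K : set G) (B : 'rV[R[i]%C]_n -> 'rV[R[i]%C]_n -> R[i]%C)
    (Gamma : finGroupType)
    (eta : Gamma -> holAut X) (a : Gamma -> outG G) (mu : Gamma -> R[i]%C)
    (theta : Gamma -> lieAut G)
    (hX : compact_riemann_surface X)
    (hG : connected [set: G]) (ssG : semisimple G)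
    (hGamma : finite_subgroup eta a mu)
    (htheta : is_lift a theta)
    (hK : maximal_compact K)
    (thetaK : forall (g : Gamma) (k : G), K k -> K (theta g k))
    (hB : invariant_form G B) :
  let M_tilde := @moduli_twisted R X n G K B Gamma eta mu theta in
  let M_fixed := @moduli_fixed R X n G K B Gamma eta a mu in
  let M_star := @moduli_stable_simple R X n G K B in
  [/\ \bigcup_(c in Z2 a) M_tilde c `<=` M_fixed,
      M_star `&` M_fixed `<=` \bigcup_(c in Z2 a) M_tilde c,
      forall c, Z2 a c ->
        M_star `&` M_tilde c = (M_star `&` M_fixed) `&` M_tilde c &
      forall c c', Z2 a c -> Z2 a c' -> H2_class a c <> H2_class a c' ->
        (M_star `&` M_tilde c) `&` (M_star `&` M_tilde c') = set0].
Proof.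
(* A point of [X] provides a nonempty fibre on which to test identities in [G]. *)
have [[x0 _] _ _] := hX.
have fixed := moduli_twisted_fixed (K := K) (B := B) (eta := eta) (mu := mu) htheta.
split.
- by move=> m [c _ /fixed].
- exact: stable_simple_fixed_twisted.
(* By the first inclusion, [M_tilde c] already lies in [M_fixed]. *)
- by move=> c _; rewrite -setIA (setIidr (fixed c)).
- by move=> c c' Zc _; exact: twisted_disjoint.
Qed.
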